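(* Let \( 1\leq p <\infty \). Then, under CH, the following isometric isomorphism holds: $L^{p}(\mu)\cong \ell^{p}(\mathfrak{c},L^{p}[0,1])$.
   Context: Let $\mathcal{B}$ be the Borel $\sigma$-algebra of $\mathbb{R}$, $\lambda$ the Lebesgue measure on $(\mathbb{R},\mathcal{B})$, and $\mathcal{B}_{\infty}$ the $\sigma$-algebra on $\mathbb{R}^{\mathbb{N}}$ generated by the cylinder sets $\prod_{i=1}^{m}C_{i}\times\prod_{i=m+1}^{\infty}\mathbb{R}$ with $C_i\in\mathcal{B}$, $m\in\mathbb{N}$ (it coincides with the Borel $\sigma$-algebra of the product topology). Let $\mathcal{F}(\mathcal{B},\lambda)$ be the set of finite rectangles $\prod_{i\in\mathbb{N}}C_{i}$ with $C_i\in\mathcal{B}$ and $\prod_{i\in\mathbb{N}}\lambda(C_i)\in[0,\infty)$, with $\mathrm{vol}(\prod_{i}C_i):=\prod_i\lambda(C_i)$. The measure $\mu$ is the restriction to $\mathcal{B}_{\infty}$ of the outer measure $\mu^{\ast}(A):=\inf\{\sum_{n}\mathrm{vol}(\mathscr{C}_{n}) : \mathscr{C}_{n}\in\mathcal{F}(\mathcal{B},\lambda),\ A\subset\bigcup_{n}\mathscr{C}_{n}\}$ (with $\inf\varnothing=\infty$). For a set $J$ and a Banach space $X$, $\ell^{p}(J,X)$ is the space of families $(x_j)_{j\in J}$ in $X$ with $\sum_{j}\|x_j\|^{p}<\infty$, normed by $(\sum_j\|x_j\|^p)^{1/p}$; $\mathfrak{c}$ is the cardinality of the continuum and CH is the continuum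 hypothesis. *)

(* Defs.v *)
From HB Require Import structures.
From mathcomp Require Import all_boot all_order all_algebra.
From mathcomp Require Import all_classical all_reals all_analysis.
Set Implicit Arguments. Unset Strict Implicit. Unset Printing Implicit Defensive.
Import Order.TTheory GRing.Theory Num.Theory.
Import numFieldNormedType.Exports.
Local Open Scope classical_set_scope.
Local Open Scope ring_scope.

Section BakerSpace.
Variable R : realType.

Definition cylinders : set (set (nat -> R)) :=
  [set A | exists (m : nat) (C : nat -> set R),
     (forall i, measurable (C i)) /\
     A = [set x | forall i, (i < m)%N -> C i (x i)]].

Definition RN := g_sigma_algebraType cylinders.

Definition rect (C : nat -> set R) : set RN := [set x | forall i, C i (x i)].

Definition partial_vol (C : nat -> set R) (n : nat) : \bar R :=
  (\prod_(i < n) (@lebesgue_measure R) (C i))%E.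

Definition vol (C : nat -> set R) : \bar R := lim (partial_vol C @ \oo).

Definition finite_rect (C : nat -> set R) : Prop :=
  (forall i, measurable (C i)) /\
  exists r : R, (0 <= r) /\ partial_vol C @ \oo --> r%:E.

(** The outer measure mu^* (inf over countable covers by finite rectangles;
    inf of the empty set is +oo). *)
Definition mu_star (A : set RN) : \bar R :=
  ereal_inf [set (\sum_(0 <= n <oo) vol (D n))%E |
               D in [set D : nat -> nat -> set R |
                      (forall n, finite_rect (D n)) /\
                      A `<=` \bigcup_n rect (D n)]].

(** mu: the restriction of mu^* to B_infty (integration only evaluates it
    on measurable sets). *)
Definition mu : set RN -> \bar R :=
  fun A => if `[< measurable A >] then mu_star A else 0%E.

Definition mu_ae (P : RN -> Prop) : Prop :=
  exists N : set RN, measurable N /\ mu N = 0%E /\ ~` [set x | P x] `<=` N.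

Definition Lp_mu (p : R) (f : RN -> R) : Prop :=
  measurable_fun [set: RN] f /\
  (\int[mu]_x ((`|f x| `^ p)%:E) < +oo)%E.

Definition Lp_mu_norm (p : R) (f : RN -> R) : \bar R :=
  poweR (\int[mu]_x ((`|f x| `^ p)%:E))%E p^-1.

Definition Lp01 (p : R) (g : R -> R) : Prop :=
  measurable_fun (`[0%R, 1%R] : set R) g /\
  (\int[@lebesgue_measure R]_(x in `[0%R, 1%R]) ((`|g x| `^ p)%:E) < +oo)%E.

Definition Lp01_norm (p : R) (g : R -> R) : \bar R :=
  poweR (\int[@lebesgue_measure R]_(x in `[0%R, 1%R]) ((`|g x| `^ p)%:E))%E p^-1.

Definition ae01_eq (g h : R -> R) : Prop :=
  {ae @lebesgue_measure R, forall x, (`[0%R, 1%R]%classic : set R) x -> g x = h x}.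

Definition lp_fam (J : choiceType) (p : R) (G : J -> R -> R) : Prop :=
  (forall j, Lp01 p (G j)) /\
  (\esum_(j in [set: J]) poweR (Lp01_norm p (G j)) p < +oo)%E.

Definition lp_fam_norm (J : choiceType) (p : R) (G : J -> R -> R) : \bar R :=
  poweR (\esum_(j in [set: J]) poweR (Lp01_norm p (G j)) p)%E p^-1.

Definition CH : Prop :=
  forall A : set R, countable A \/ (A #= [set: R])%card.

(** Isometric (real-)linear isomorphism  L^p(mu) ~= l^p(J, L^p[0,1]),
    both spaces being taken modulo a.e. equality. *)
Definition isometric_iso_Lp_mu_lp (J : choiceType) (p : R) : Prop :=
  exists T : (RN -> R) -> J -> R -> R,
    (forall f, Lp_mu p f -> lp_fam p (T f)) /\
    (forall f g, Lp_mu p f -> Lp_mu p g -> mu_ae (fun x => f x = g x) ->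
       forall j, ae01_eq (T f j) (T g j)) /\
    (forall (a b : R) f g, Lp_mu p f -> Lp_mu p g ->
       forall j, ae01_eq (T (fun x => a * f x + b * g x) j)
                         (fun t => a * T f j t + b * T g j t)) /\
    (forall f, Lp_mu p f -> lp_fam_norm p (T f) = Lp_mu_norm p f) /\
    (forall G, lp_fam p G -> exists f, Lp_mu p f /\
       forall j, ae01_eq (T f j) (G j)).

End BakerSpace.

(* Main.v *)
Require Import Defs.
From HB Require Import structures.
From mathcomp Require Import finmap all_boot all_order all_algebra.
From mathcomp Require Import all_classical all_reals all_analysis.
From mathcomp Require Import measurable_realfun lra.
Import Order.TTheory GRing.Theory Num.Theory.
Import numFieldNormedType.Exports.
Local Open Scope classical_set_scope.
Local Open Scope ring_scope.
Set Implicit Arguments. Unset Strict Implicit. Unset Printing Implicit Defensive.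

(** [mu] is a measure by Caratheodory's criterion: a finite rectangle split
    along one side stays a pair of finite rectangles whose volumes add up.
    Points are [mu]-null, and [R^N] is Borel-embedded in [R] with a Borel left
    inverse, so every set [E] with [0 < mu E < oo] is isomorphic, up to scaling
    and null sets, to [[0, 1]]: transport the conditional probability on [E] to
    [R] and use its distribution function and its quantile function.

    By Zorn's lemma there is a maximal family of sets of positive finite measure
    with pairwise null intersections.  Such sets are separated by the rational
    values of the distribution functions of the embedding, so the family injects
    into [R].  It is uncountable, because each of its members meets only
    countably many of the uncountably many disjoint unit cubes
    [prod_i [b_i, b_i + 1[], each of which has measure 1.  By CH the family is
    thus indexed by [R].  A function in [L^p(mu)] has sigma-finite support, hence
    lives on countably many members of the family, and reading it on each member
    through the isomorphism with [[0, 1]] is the isometry. *)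

(** * Distribution functions and quantile functions *)

Local Notation uniform01 R := (uniform_prob (@ltr01 R)).

Section cumulative_distribution.
Context {R : realType}.
Local Open Scope ereal_scope.

Lemma eq_measure_rays (m1 m2 : {measure set R -> \bar R}) : m1 setT < +oo ->
  (forall r, m1 `]r, +oo[%classic = m2 `]r, +oo[%classic) ->
  forall A, measurable A -> m1 A = m2 A.
Proof.
move=> m1_lty m12; apply: (measure_unique _ (fun n => `](- n%:R : R)%R, +oo[%classic)
  (RGenOInfty.measurableE R)).
- move=> _ _ [r ->] [s ->]; exists (Num.max r s).
  by apply/seteqP; split=> x /=; rewrite !in_itv/= !andbT gt_max => /andP.
- by move=> n; exists (- n%:R)%R.
- apply/seteqP; split=> // x _; exists (Num.truncn (- x)).+1 => //=.
  by rewrite in_itv/= andbT ltrNl truncnS_gt.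
- by move=> _ [r ->].
- by move=> n; apply: le_lt_trans m1_lty; apply: le_measure; rewrite ?inE.
Qed.

Lemma cdf_lt_right d (T : measurableType d) (P : probability T R)
    (X : {RV P >-> R}) (r : R) (a : \bar R) :
  cdf X r < a -> exists2 s, (r < s)%R & cdf X s < a.
Proof.
move=> /open_ereal_lt_ereal ra.
have [e /= e0 near_r] := cdf_right_continuous (X := X) ra.
exists (r + e / 2)%R; first by rewrite ltrDl divr_gt0.
apply: near_r => /=; last by rewrite ltrDl divr_gt0.
by rewrite opprD addNKr normrN gtr0_norm ?divr_gt0// ltr_pdivrMr// ltr_pMr// ltr1n.
Qed.

Lemma le_cdf_rat d1 d2 (T1 : measurableType d1) (T2 : measurableType d2)
    (P1 : probability T1 R) (P2 : probability T2 R)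
    (X1 : {RV P1 >-> R}) (X2 : {RV P2 >-> R}) :
  (forall q : rat, cdf X1 (ratr q) <= cdf X2 (ratr q)) ->
  forall r, cdf X1 r <= cdf X2 r.
Proof.
move=> X12 r; rewrite leNgt; apply/negP => /cdf_lt_right[s rs].
have [q] := rat_in_itvoo rs; rewrite in_itv/= => /andP[rq qs].
apply/negP; rewrite -leNgt; apply: (@le_trans _ _ (cdf X1 (ratr q))).
  by apply: cdf_nondecreasing; exact: ltW.
by apply: (le_trans (X12 q)); apply: cdf_nondecreasing; exact: ltW.
Qed.

Lemma eq_distribution_cdf_rat d1 d2 (T1 : measurableType d1) (T2 : measurableType d2)
    (P1 : probability T1 R) (P2 : probability T2 R)
    (X1 : {RV P1 >-> R}) (X2 : {RV P2 >-> R}) :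
  (forall q : rat, cdf X1 (ratr q) = cdf X2 (ratr q)) ->
  forall A, measurable A -> distribution P1 X1 A = distribution P2 X2 A.
Proof.
move=> X12; apply: (@eq_measure_rays (distribution P1 X1) (distribution P2 X2)).
  by rewrite -ge0_fin_numE// fin_num_measure.
move=> r; rewrite -[LHS]/(ccdf X1 r) -[RHS]/(ccdf X2 r) !ccdf_1_cdf; congr (1 - _).
by apply/eqP; rewrite eq_le; apply/andP; split; apply: le_cdf_rat => q; rewrite X12.
Qed.

End cumulative_distribution.

Section uniform01.
Context {R : realType}.
Local Open Scope ereal_scope.

(* Unification does not find the library's instance for [lebesgue_measure]. *)
#[global] Instance ae_lebesgue_filter :
  Filter (nbhs (almost_everywhere (@lebesgue_measure R))).
Proof. exact: (ae_filter_ringOfSetsType (@lebesgue_measure R)). Qed.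

Lemma uniform01E (A : set R) : measurable A ->
  uniform01 R A = lebesgue_measure (`[0%R, 1%R] `&` A).
Proof.
move=> mA.
have mi : measurable_fun [set: measurableTypeR R] (fun x => (\1_A x : R)%:E).
  by apply/measurable_EFinP; exact: measurable_indic.
have := integral_uniform (@ltr01 R) mi.
rewrite integral_indic// setIT => ->; last by move=> x; rewrite lee_fin.
by rewrite subr0 invr1 mul1e integral_indic// setIC.
Qed.

Lemma ae_uniform01_lebesgue (Q : R -> Prop) :
  {ae uniform01 R, forall u, Q u} ->
  {ae lebesgue_measure, forall u, `[0%R, 1%R]%classic u -> Q u}.
Proof.
move=> [N [mN N0 QN]]; exists (`[0%R, 1%R]%classic `&` N); split.
- by apply: measurableI => //; exact: measurable_itv.
- by rewrite -[LHS]uniform01E.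
- by move=> u /= /not_implyP[u01 nQ]; split => //; exact: QN.
Qed.

Lemma uniform01_ooE (A : set R) : measurable A ->
  uniform01 R A = lebesgue_measure (`]0%R, 1%R[ `&` A).
Proof.
move=> mA; rewrite uniform01E//.
rewrite -(@setUitv_set2 _ R 0%R 1%R false true)// setIUl measureU0//.
- exact: measurableI.
- by apply: measurableI => //; exact: measurableU.
- apply: countable_lebesgue_measure0; apply: (@sub_countable _ _ _ [set 0%R; 1%R]).
    exact: subset_card_le.
  exact: finite_set_countable.
Qed.

Lemma ae_uniform01_oo : {ae uniform01 R, forall u, (0 < u < 1)%R}.
Proof.
have mC : measurable (~` `]0%R, 1%R[ : set R).
  by apply: measurableC; exact: measurable_itv.
exists (~` `]0%R, 1%R[); split => //.
by rewrite uniform01_ooE// setICr measure0.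
Qed.

End uniform01.

Section quantile.
Context {R : realType} d (T : measurableType d) (P : probability T R).
Variable X : {RV P >-> R}.
Local Open Scope ereal_scope.

(* The value [0] outside of [`]0, 1[] is junk. *)
Definition quantile (u : measurableTypeR R) : R :=
  if (0 < u < 1)%R then inf [set r | u%:E <= cdf X r] else 0%R.

Lemma has_inf_quantile u : (0 < u < 1)%R -> has_inf [set r | u%:E <= cdf X r].
Proof.
move=> /andP[u0 u1]; split.
  have u1E : u%:E < 1 by rewrite lte_fin.
  have [r [_ /(_ (r + 1)%R)]] := cvg_cdfy1 X (open_ereal_gt_ereal u1E).
  by rewrite ltrDl ltr01 => /(_ isT)/ltW ?; exists (r + 1)%R.
have u0E : 0 < u%:E by rewrite lte_fin.
have [r [_ le_r]] := cvg_cdfNy0 X (open_ereal_lt_ereal u0E).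
exists r => s; apply: contraTT; rewrite -!ltNge; exact: le_r.
Qed.

Lemma quantile_le u r : (0 < u < 1)%R -> (quantile u <= r)%R = (u%:E <= cdf X r).
Proof.
move=> u01; rewrite /quantile u01; set S := [set r | _].
have infS : has_inf S := has_inf_quantile u01.
apply/idP/idP => [infr|ur]; last exact: (ge_inf infS.2).
rewrite leNgt; apply/negP => /cdf_lt_right[s rs]; apply/negP; rewrite -leNgt.
have /(inf_adherent)/(_ infS)[t St ts] : (0 < s - inf S)%R.
  by rewrite subr_gt0 (le_lt_trans infr).
by apply: (le_trans St); apply: cdf_nondecreasing; move: ts; rewrite subrKC => /ltW.
Qed.

Lemma measurable_quantile : measurable_fun setT quantile.
Proof.
apply: (measurability _ (RGenOInfty.measurableE R)) => _ [_ [r ->] <-].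
rewrite setTI preimage_itvoy.
pose gt_r u := if (0 < u < 1)%R then (fine (cdf X r) < u)%R else (r < 0)%R.
rewrite (_ : [set u | _] = gt_r @^-1` [set true]).
  rewrite -[X in measurable X]setTI; apply: measurable_fun_if => //.
  - by apply: measurable_and => //; exact: measurable_fun_ltr.
  - exact: measurable_fun_ltr.
apply/seteqP; suff gt_rE u : (r < quantile u)%R = gt_r u by split=> u /=; rewrite gt_rE.
rewrite /gt_r; case: ifPn => u01; last by rewrite /quantile (negbTE u01).
by rewrite ltNge quantile_le// -ltNge -lte_fin fineK// fin_num_measure.
Qed.

HB.instance Definition _ := isMeasurableFun.Build _ _ _ _ quantile measurable_quantile.

Lemma cdf_quantile r : cdf (quantile : {RV uniform01 R >-> R}) r = cdf X r.
Proof.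
have [F [F0 F1 FE]] : exists F, [/\ (0 <= F)%R, (F <= 1)%R & cdf X r = F%:E].
  exists (fine (cdf X r)).
  by split; rewrite ?fineK ?fin_num_measure// -lee_fin fineK ?fin_num_measure// cdf_le1.
rewrite FE -[LHS]/(uniform01 R (quantile @^-1` `]-oo, r]%classic)).
rewrite uniform01_ooE//; last first.
  by rewrite -[X in measurable X]setTI; exact: measurable_quantile.
rewrite (_ : _ `&` _ = `]0%R, 1%R[ `&` `]-oo, F]); last first.
  apply/seteqP; split=> u [u01] /=; rewrite !in_itv/= quantile_le ?FE//.
rewrite -set_itvI lebesgue_measure_itv/= (meet_r F1) lte_fin sube0.
by case: ltP => // F_le0; congr EFin; apply/eqP; rewrite eq_le F0.
Qed.

Lemma distribution_quantile A : measurable A ->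
  uniform01 R (quantile @^-1` A) = distribution P X A.
Proof.
apply: (eq_distribution_cdf_rat (X1 := quantile : {RV uniform01 R >-> R})).
by move=> q; exact: cdf_quantile.
Qed.

Hypothesis nonatomic : forall r, P (X @^-1` [set r]) = 0.

Lemma quantileK u : (0 < u < 1)%R -> cdf X (quantile u) = u%:E.
Proof.
move=> u01; apply/eqP; rewrite eq_le andbC -quantile_le// lexx/=.
set q := quantile u.
have -> : cdf X q = distribution P X `]-oo, q[%classic.
  rewrite /cdf -(@setUitv1 _ _ -oo%O q true)// measureU0//.
  exact: nonatomic.
pose below n := `]-oo, (q - n.+1%:R^-1)%R]%classic.
have -> : `]-oo, q[%classic = \bigcup_n below n.
  apply/seteqP; split=> [x|x [n _]]; rewrite /below/= !in_itv/=.
    by move=> /ltr_add_invr[n xq]; exists n => //=; rewrite in_itv/= lerBrDr ltW.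
  by move=> /le_lt_trans; apply; rewrite gtrBl invr_gt0.
have : distribution P X (below n) @[n --> \oo] --> distribution P X (\bigcup_n below n).
  have mbelow n : measurable (below n) by exact: measurable_itv.
  apply: nondecreasing_cvg_mu => //; first exact: bigcupT_measurable.
  move=> m n mn; apply/subsetPset/subset_itvl; rewrite bnd_simp lerB//.
  by rewrite lef_pV2 ?posrE// ler_nat.
move=> cvg_below; rewrite -(cvg_lim _ cvg_below)//.
apply: lime_le; first by apply/cvg_ex; eexists; exact: cvg_below.
apply: nearW => n; apply: ltW; rewrite ltNge -[leRHS]/(cdf X _) -quantile_le//.
by rewrite -ltNge gtrBl invr_gt0.
Qed.

End quantile.

(** * Charts of sets of positive finite measure *)

Record borel_embedding d (T : measurableType d) (R : realType) := BorelEmbedding {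
  embed :> {mfun T >-> R};
  retract : {mfun R >-> T};
  embedK : cancel embed retract }.

Section embedded_probability.
Context d (T : measurableType d) (R : realType).
Variables (iota : borel_embedding T R) (P : probability T R).
Local Open Scope ereal_scope.

Let X : {RV P >-> R} := embed iota.

Lemma embed_set1 x : iota @^-1` [set iota x] = [set x].
Proof. by apply/seteqP; split=> [y /= /(can_inj (embedK iota))|_ ->]. Qed.

Lemma embed_fiber_eq0 : (forall x, P [set x] = 0) -> forall r, P (X @^-1` [set r]) = 0.
Proof.
move=> P0 r; have [[x <-]|no_x] := pselect (exists x, iota x = r).
  by rewrite -[RHS](P0 x); congr (P _); exact: embed_set1.
rewrite (_ : _ @^-1` _ = set0) ?measure0// -subset0 => x Xx.
by apply: no_x; exists x.
Qed.

Lemma ae_embed_retract_quantile : {ae uniform01 R,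
  forall u, iota (retract iota (quantile X u)) = quantile X u}.
Proof.
pose B := [set r | (iota (retract iota r) == r) = false].
have mB : measurable B.
  have : measurable_fun [set: R] (fun r => iota (retract iota r) == r).
    by apply: measurable_fun_eqr => //; exact: measurableT_comp.
  by move=> /(_ measurableT [set false]); rewrite setTI; apply.
exists (quantile X @^-1` B); split; first exact: measurable_funPTI.
- rewrite distribution_quantile// /distribution /pushforward.
  rewrite (_ : _ @^-1` _ = set0) ?measure0// -subset0 => x /=.
  by rewrite /B/= embedK eqxx.
- by move=> u /= => /eqP/negbTE.
Qed.

End embedded_probability.

Definition finite_positive d (T : measurableType d) (R : realType)
    (m : set T -> \bar R) (E : set T) : Prop :=
  [/\ measurable E, (0 < m E)%E & (m E < +oo)%E].

Section conditional_probability.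
Context d (T : measurableType d) (R : realType).
Variables (m : {measure set T -> \bar R}) (E : set T) (mE : measurable E).
Local Open Scope ereal_scope.

Definition cond_prob : probability T R := mnormalize (mrestr m mE) point.

Hypotheses (E_gt0 : 0 < m E) (E_lty : m E < +oo).

Lemma cond_probE A : cond_prob A * m E = m (A `&` E).
Proof.
rewrite /cond_prob/= /mnormalize/= /mrestr !setTI.
rewrite (gt_eqF E_gt0) (lt_eqF E_lty)/= -muleA.
rewrite -[X in _ * (_ * X)]fineK ?ge0_fin_numE// -EFinM mulVf ?mule1//.
by rewrite gt_eqF// fine_gt0// E_gt0.
Qed.

Lemma cond_prob_eq0 A : m (A `&` E) = 0 -> cond_prob A = 0.
Proof.
by rewrite -cond_probE => /eqP; rewrite mule_eq0 (gt_eqF E_gt0) orbF => /eqP.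
Qed.

End conditional_probability.

(* Modulo null sets, a unit chart is an isomorphism of [`[0, 1]] with [E],
   up to the factor [m E]. *)
Record unit_chart d (T : measurableType d) (R : realType) (m : set T -> \bar R)
    (E : set T) := UnitChart {
  chart : {mfun measurableTypeR R >-> T};
  cochart : {mfun T >-> R};
  chart_measure : forall A, measurable A ->
    (uniform01 R (chart @^-1` A) * m E = m (A `&` E))%E;
  chartK : {ae uniform01 R, forall u, cochart (chart u) = u} }.

Lemma nonatomic_unit_chart d (T : measurableType d) (R : realType)
    (m : {measure set T -> \bar R}) (iota : borel_embedding T R) (E : set T) :
  (forall x, m [set x] = 0%E) -> finite_positive m E -> unit_chart m E.
Proof.
move=> m_nonatomic [mE E_gt0 E_lty].
pose P := cond_prob m mE; pose X : {RV P >-> R} := embed iota.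
have P_nonatomic x : P [set x] = 0%E.
  have mx : measurable [set x] by rewrite -(embed_set1 iota); exact: measurable_funPTI.
  apply: cond_prob_eq0 => //; apply: (subset_measure0 _ mx _ (m_nonatomic x)) => //.
  exact: measurableI.
have mcdf : measurable_fun setT (fine \o cdf X).
  by apply: measurableT_comp => //; exact: cdf_measurable.
have mcochart : measurable_fun setT (fine \o cdf X \o iota) by exact: measurableT_comp.
pose c : {mfun measurableTypeR R >-> T} := retract iota \o quantile X.
pose co : {mfun T >-> R} :=
  HB.pack (fine \o cdf X \o iota) (isMeasurableFun.Build _ _ _ _ _ mcochart).
apply: (@UnitChart _ _ _ m E c co) => [A mA|].
  rewrite comp_preimage distribution_quantile; last exact: measurable_funPTI.
  rewrite /distribution /pushforward -comp_preimage -(cond_probE mE)//.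
  by congr (P _ * _)%E; apply/seteqP; split=> x /=; rewrite embedK.
apply: filterS2 (ae_embed_retract_quantile iota P) ae_uniform01_oo => u qE u01.
by rewrite -[LHS]/(fine (cdf X (iota (c u)))) qE quantileK//; exact: embed_fiber_eq0.
Qed.

Lemma integral_mrestr d (T : measurableType d) (R : realType)
    (m : {measure set T -> \bar R}) (D : set T) (mD : measurable D) (h : T -> \bar R) :
  measurable_fun setT h -> (forall x, 0 <= h x)%E ->
  (\int[mrestr m mD]_x h x = \int[m]_(x in D) h x)%E.
Proof.
move=> mh h0.
rewrite (@ge0_negligible_integral _ _ _ (mrestr m mD) setT (~` D))//; last 2 first.
- exact: measurableC.
- by rewrite /= /mrestr setICl measure0.
rewrite setDE setCK setTI; apply: eq_measure_integral => A mA AD.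
by rewrite /= /mrestr (setIidl AD).
Qed.

Section unit_chart_theory.
Context d (T : measurableType d) (R : realType).
Variables (m : {measure set T -> \bar R}) (E : set T) (c : unit_chart m E).
Hypothesis posE : finite_positive m E.
Local Open Scope ereal_scope.

Lemma ae_chart (Q : T -> Prop) : m.-negligible (E `\` [set x | Q x]) ->
  {ae uniform01 R, forall u, Q (chart c u)}.
Proof.
move=> [N [mN N0 EQN]]; have [mE E_gt0 _] := posE.
have mNE : measurable (N `|` ~` E) by apply: measurableU => //; exact: measurableC.
exists (chart c @^-1` (N `|` ~` E)); split; first exact: measurable_funPTI.
- have /eqP := chart_measure c mNE.
  have NE0 : m (N `&` E) = 0.
    by apply: (subset_measure0 _ mN _ N0) => //; exact: measurableI.
  by rewrite setIUl setICl setU0 NE0 mule_eq0 (gt_eqF E_gt0) orbF => /eqP.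
- move=> u /= nQ; have [Eu|nE] := pselect (E (chart c u)); last by right.
  by left; apply: EQN.
Qed.

Lemma integral_chart (h : T -> \bar R) : measurable_fun setT h -> (forall x, 0 <= h x) ->
  (\int[lebesgue_measure]_(u in `[0%R, 1%R]) h (chart c u)) * m E = \int[m]_(x in E) h x.
Proof.
move=> mh h0; have [mE _ E_lty] := posE.
have mhc : measurable_fun setT (h \o chart c) by exact: measurableT_comp.
have := integral_uniform (@ltr01 R) mhc (fun u => h0 (chart c u)).
rewrite subr0 invr1 mul1e => <-.
rewrite -[X in X * _](@ge0_integral_pushforward _ _ _ _ _ (chart c) _
  (uniform01 R) setT h)//.
rewrite -[in X in _ * X](@fineK _ (m E)) ?ge0_fin_numE//.
pose r : {nonneg R} := NngNum (fine_ge0 (measure_ge0 m E)).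
rewrite muleC -[fine _]/(r%:num).
rewrite -(ge0_integral_mscale (distribution (uniform01 R) (chart c)))//.
rewrite -(integral_mrestr m mE)//; apply: eq_measure_integral => A mA _.
by rewrite /= /mscale/= /mrestr -(chart_measure c mA) fineK ?ge0_fin_numE// muleC.
Qed.

End unit_chart_theory.

(** * Almost disjoint families *)

Lemma countable_enum (I : pointedType) (D : set I) : countable D ->
  exists e : nat -> I, D `<=` range e.
Proof.
move=> /pfcard_geP[->|[f]]; first by exists (fun=> point).
by exists f => i Di; have [n _ <-] := @surj _ _ _ _ f i Di; exists n.
Qed.

Lemma uncountable_bool_seq : ~ countable [set: nat -> bool].
Proof.
move=> /countable_enum[e e_surj].
have [k _ /(congr1 (@^~ k))] := e_surj (fun n => ~~ e n n) I.
by case: (e k k).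
Qed.

Lemma ex_invr_le (R : realType) (x : \bar R) :
  (0 < x)%E -> exists n, ((n.+1%:R^-1)%:E <= x)%E.
Proof.
move=> x0; have [r r0 rx] : exists2 r : R, 0 < r & (r%:E <= x)%E.
  case: x x0 => [r r0|_|//]; first by exists r; rewrite -?lte_fin.
  by exists 1 => //; rewrite leey.
have [n] := ltr_add_invr r0; rewrite add0r => nr; exists n.
by apply: le_trans rx; rewrite lee_fin ltW.
Qed.

Lemma set_gt0E (R : realType) (I : Type) (a : I -> \bar R) :
  [set i | 0 < a i]%E = \bigcup_n [set i | (n.+1%:R^-1)%:E <= a i]%E.
Proof.
apply/seteqP; split=> [i /ex_invr_le[n ?]|i [n _ /=]]; first by exists n.
by apply: lt_le_trans; rewrite lte_fin invr_gt0.
Qed.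

Lemma esum_countable (R : realType) (I : choiceType) (a : I -> \bar R) :
  (forall i, 0 <= a i)%E -> (\esum_(i in setT) a i < +oo)%E ->
  countable [set i | 0 < a i]%E.
Proof.
move=> a0 suma_lty; rewrite set_gt0E; apply: bigcup_countable => // n _.
apply: finite_set_countable; set ge_inv := [set i | _].
apply: contrapT => inf_ge_inv.
have [M sumaE] : exists M : R, (\esum_(i in setT) a i)%E = M%:E.
  by exists (fine (\esum_(i in setT) a i)%E); rewrite fineK// ge0_fin_numE// esum_ge0.
have [B B_ge_inv cardB] := infinite_set_fset ((Num.truncn M).+1 * n.+1) inf_ge_inv.
have : (\sum_(i <- B) (n.+1%:R^-1)%:E <= M%:E)%E.
  rewrite -sumaE; apply: esum_ge; exists [set` B]; first by split.
  rewrite fsbig_finite//= set_fsetK big_seq [leRHS]big_seq.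
  by apply: lee_sum => i /B_ge_inv.
rewrite sumEFin lee_fin big_const_seq count_predT iter_addr_0 leNgt => /negP; apply.
rewrite -[ltRHS]mulr_natl ltr_pdivlMr//.
apply: (@lt_le_trans _ _ ((Num.truncn M).+1 * n.+1)%:R).
  by rewrite natrM ltr_pM2r// truncnS_gt.
by rewrite ler_nat.
Qed.

Section almost_disjoint.
Context d (T : measurableType d) (R : realType).
Variable m : {measure set T -> \bar R}.
Local Open Scope ereal_scope.

Lemma integral_setU_null_meet (A B : set T) (h : T -> \bar R) :
  measurable A -> measurable B -> m (A `&` B) = 0 ->
  measurable_fun setT h -> (forall x, 0 <= h x) ->
  \int[m]_(x in A `|` B) h x = \int[m]_(x in A) h x + \int[m]_(x in B) h x.
Proof.
move=> mA mB AB0 mh h0; have mAB : measurable (A `&` B) by exact: measurableI.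
rewrite [in RHS](ge0_negligible_integral mAB mA)//; last exact: measurable_funTS.
rewrite -ge0_integral_setU//; first by rewrite setDIr setDv set0U setUDl setDv setD0.
- exact: measurableD.
- exact: measurable_funTS.
- by apply/disj_setPS => x [[Ax nABx] Bx]; apply: nABx.
Qed.

Definition almost_disjoint (I : eqType) (F : I -> set T) :=
  forall i j, i != j -> m (F i `&` F j) = 0.

Section family.
Variables (I : choiceType) (F : I -> set T).
Hypotheses (mF : forall i, measurable (F i)) (disjF : almost_disjoint F).

Lemma integral_bigsetU_almost_disjoint (s : seq I) (h : T -> \bar R) : uniq s ->
  measurable_fun setT h -> (forall x, 0 <= h x) ->
  \int[m]_(x in \big[setU/set0]_(i <- s) F i) h x = \sum_(i <- s) \int[m]_(x in F i) h x.
Proof.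
move=> + mh h0; elim: s => [|i s IHs] /=; first by rewrite !big_nil integral_set0.
move=> /andP[i_notin us]; rewrite !big_cons -IHs//.
have mU : measurable (\big[setU/set0]_(j <- s) F j) by exact: bigsetU_measurable.
rewrite integral_setU_null_meet//; apply/(negligibleP m); first exact: measurableI.
rewrite big_distrr/= big_seq; apply: big_ind => [|A B|j js].
- exact: negligible_set0.
- exact: negligibleU.
apply/negligibleP; first exact: measurableI.
by apply: disjF; apply: contraNneq i_notin => ->.
Qed.

Lemma esum_integral_almost_disjoint_le (h : T -> \bar R) :
  measurable_fun setT h -> (forall x, 0 <= h x) ->
  \esum_(i in setT) \int[m]_(x in F i) h x <= \int[m]_x h x.
Proof.
move=> mh h0; apply: ge_ereal_sup => _ [X [finX _] <-].
rewrite fsbig_finite//= -integral_bigsetU_almost_disjoint//.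
by apply: ge0_subset_integral => //; exact: bigsetU_measurable.
Qed.

Lemma integral_bigcup_le_esum (e : nat -> I) (h : T -> \bar R) :
  measurable_fun setT h -> (forall x, 0 <= h x) ->
  \int[m]_(x in \bigcup_k F (e k)) h x <= \esum_(i in setT) \int[m]_(x in F i) h x.
Proof.
move=> mh h0; rewrite -bigcup_bigsetU_bigcup.
set G := fun n => \big[setU/set0]_(k < n.+1) F (e k).
have cvgG : \int[m]_(x in G n) h x @[n --> \oo] --> \int[m]_(x in \bigcup_n G n) h x.
  apply: ge0_nondecreasing_set_cvg_integral => //.
  - by move=> i j ij; apply/subsetPset => x; apply: (subset_bigsetU (F := F \o e)).
  - by move=> n; exact: bigsetU_measurable.
  - by move=> n; exact: measurable_funTS.
rewrite -(cvg_lim _ cvgG)//; apply: lime_le; first by apply/cvg_ex; eexists; exact: cvgG.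
apply: nearW => n; pose s := undup (map e (iota 0 n.+1)).
have -> : G n = \big[setU/set0]_(i <- s) F i.
  rewrite big_undup ?big_map -?[iota 0 n.+1]/(index_iota 0 n.+1) ?big_mkord//.
  exact: setUid.
rewrite integral_bigsetU_almost_disjoint ?undup_uniq//.
apply: esum_ge; exists [set` s]; first by split => //; exact: finite_seq.
by rewrite -fsbig_seq ?undup_uniq.
Qed.

Lemma almost_disjoint_countable (A : set T) : measurable A -> m A < +oo ->
  countable [set i | 0 < m (A `&` F i)].
Proof.
move=> mA A_lty; apply: esum_countable => //; apply: le_lt_trans A_lty.
have mi : measurable_fun [set: T] (fun x => (\1_A x : R)%:E).
  by apply/measurable_EFinP; exact: measurable_indic.
have := esum_integral_almost_disjoint_le mi _.
rewrite integral_indic// setIT; under eq_esum do rewrite integral_indic//.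
by apply => x; rewrite lee_fin.
Qed.

End family.
End almost_disjoint.

Section almost_partition.
Context d (T : measurableType d) (R : realType).
Variable m : {measure set T -> \bar R}.
Local Open Scope ereal_scope.

Record almost_partition (I : Type) (D : set I) (F : I -> set T) : Prop :=
  AlmostPartition {
  partition_positive : forall i, D i -> finite_positive m (F i);
  partition_disjoint : forall i j, D i -> D j -> i <> j -> m (F i `&` F j) = 0;
  partition_exhaustive : forall A, measurable A -> m A < +oo ->
    (forall i, D i -> m (A `&` F i) = 0) -> m A = 0 }.

Lemma ex_almost_partition : exists EE : set (set T), almost_partition EE id.
Proof.
pose packing (EE : set (set T)) := (forall E, EE E -> finite_positive m E) /\
  (forall A B, EE A -> EE B -> A <> B -> m (A `&` B) = 0).
have [C packC chainC|EE [[posEE disjEE] maxEE]] := @Zorn_bigcup _ packing.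
  split=> [E [X CX XE]|A B [X CX XA] [Y CY YB] AB].
    by have [/(_ _ XE)] := packC _ CX.
  have [XY|YX] := chainC _ _ CX CY.
    by have [_] := packC _ CY; apply => //; exact: XY.
  by have [_] := packC _ CX; apply => //; exact: YX.
exists EE; split => // A mA A_lty A_EE; apply: contrapT => /eqP A_neq0.
have A_gt0 : 0 < m A by rewrite lt0e A_neq0 measure_ge0.
have nEEA : ~ EE A by move=> /A_EE; rewrite setIid; exact/eqP.
apply: (maxEE (A |` EE)).
  by split=> [E|/(_ A (or_introl erefl))//]; right.
split=> [E [->//|]|B C [->|EB] [->|EC] BC]; first exact: posEE.
- by case: BC.
- exact: A_EE.
- by rewrite setIC; exact: A_EE.
- exact: disjEE.
Qed.

Lemma almost_partition_bij (I J : Type) (D : set I) (D' : set J) (F : I -> set T)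
    (e : J -> I) :
  set_bij D' D e -> almost_partition D F -> almost_partition D' (F \o e).
Proof.
move=> [eD e_inj e_surj] [posF disjF exhF]; split=> [j D'j|i j D'i D'j ij|A mA A_lty A_F].
- by apply: posF; exact: eD.
- apply: disjF; [exact: eD|exact: eD|].
  by move=> /e_inj; rewrite !inE => /(_ D'i D'j).
- by apply: exhF => // _ /e_surj[j D'j <-]; exact: A_F.
Qed.

Lemma almost_partition_uncountable (I : Type) (D : set I) (F : I -> set T)
    (J : choiceType) (K : J -> set T) : almost_partition D F ->
  (forall j, finite_positive m (K j)) -> almost_disjoint m K ->
  ~ countable [set: J] -> ~ countable D.
Proof.
move=> [posF _ exhF] posK disjK uncJ countD; apply: uncJ.
rewrite (_ : setT = \bigcup_(i in D) [set j | 0 < m (F i `&` K j)]).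
  apply: bigcup_countable => // i Di; have [mFi _ Fi_lty] := posF i Di.
  by apply: almost_disjoint_countable => // j; case: (posK j).
apply/seteqP; split=> // j _; have [mKj Kj_gt0 Kj_lty] := posK j.
apply: contrapT => meets_none; have : m (K j) = 0; last by apply/eqP; rewrite gt_eqF.
apply: exhF => // i Di; apply/eqP; apply: contra_notT meets_none => FK_neq0.
by exists i => //=; rewrite setIC lt0e FK_neq0 measure_ge0.
Qed.

Section pointed_index.
Variables (I : pointedType) (F : I -> set T).
Hypothesis partF : almost_partition setT F.

Lemma measurable_partition i : measurable (F i).
Proof. by have [] := partition_positive partF (i := i) Logic.I. Qed.

Lemma almost_disjoint_partition : almost_disjoint m F.
Proof. by move=> i j /eqP; exact: (partition_disjoint partF). Qed.

Lemma almost_partition_cover (S : set T) : sigma_finite S m ->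
  exists e : nat -> I, m (S `\` \bigcup_k F (e k)) = 0.
Proof.
move=> [S_ ->{S} S_fin].
have countJ : countable (\bigcup_n [set i | 0 < m (S_ n `&` F i)]).
  apply: bigcup_countable => // n _; have [mS S_lty] := S_fin n.
  have mF := measurable_partition; have disjF := almost_disjoint_partition.
  exact: almost_disjoint_countable mS S_lty.
have [e eJ] := countable_enum countJ; exists e.
set U := \bigcup_k F (e k).
have mU : measurable U by apply: bigcupT_measurable => k; exact: measurable_partition.
have mSU n : measurable (S_ n `\` U) by apply: measurableD => //; case: (S_fin n).
rewrite setD_bigcupl; apply/negligibleP; first exact: bigcupT_measurable.
apply: negligible_bigcup => n; apply/negligibleP => //; have [mS S_lty] := S_fin n.
apply: (partition_exhaustive partF) => // [|i _].
  by apply: le_lt_trans S_lty; apply: le_measure; rewrite ?inE//; exact: subDsetl.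
have mF := measurable_partition i.
have [SF0|SF_neq0] := eqVneq (m (S_ n `&` F i)) 0.
  apply: (subset_measure0 _ _ _ SF0); [exact: measurableI|exact: measurableI|].
  by apply: setSI; exact: subDsetl.
have [k _ ek] : range e i by apply: eJ; exists n => //=; rewrite lt0e SF_neq0 measure_ge0.
rewrite (_ : _ `&` _ = set0) ?measure0// -subset0 => x [[_ nU] Fx].
by apply: nU; exists k => //; rewrite ek.
Qed.

Lemma esum_integral_partition (h : T -> \bar R) (S : set T) :
  measurable_fun setT h -> (forall x, 0 <= h x) ->
  sigma_finite S m -> (forall x, h x != 0 -> S x) ->
  \esum_(i in setT) \int[m]_(x in F i) h x = \int[m]_x h x.
Proof.
move=> mh h0 sfinS h_supp.
have mF := measurable_partition; have disjF := almost_disjoint_partition.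
apply/eqP; rewrite eq_le esum_integral_almost_disjoint_le//=.
have [e SU0] := almost_partition_cover sfinS.
apply: le_trans (integral_bigcup_le_esum mF disjF e mh h0).
set U := \bigcup_k F (e k) in SU0 *.
have mU : measurable U by exact: bigcupT_measurable.
have mS : measurable S.
  by have [S_ -> S_fin] := sfinS; apply: bigcupT_measurable => n; case: (S_fin n).
rewrite (ge0_negligible_integral (measurableD mS mU))//.
rewrite integral_mkcond [leRHS]integral_mkcond (_ : _ \_ _ = h \_ U)//.
apply/funext => x; rewrite !patchE; have [Ux|nUx] := pselect (U x).
  by rewrite !mem_set//; split=> // -[].
rewrite (memNset nUx); case: ifPn => //; rewrite inE => -[_ nSU].
by apply: contrapT => /eqP/h_supp Sx; apply: nSU.
Qed.

End pointed_index.
End almost_partition.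

(** * A Borel embedding of sequences into the reals *)

Section ternary_code.
Context {R : realType}.
Implicit Types (b : nat -> bool) (t : R).

Definition ternary_series b : nat -> R := series (fun k => (b k)%:R / 3 ^+ k.+1).

Definition ternary_code b : R := limn (ternary_series b).

Lemma nondecreasing_ternary_series b : nondecreasing_seq (ternary_series b).
Proof.
by apply: nondecreasing_series => n _ _; rewrite divr_ge0// exprn_ge0.
Qed.

Lemma ternary_series_le b n : ternary_series b n <= 2^-1.
Proof.
suff : ternary_series b n <= 2^-1 * (1 - (3 ^+ n)^-1).
  move=> /le_trans; apply; rewrite ler_piMr// lerBlDr lerDl invr_ge0.
elim: n => [|n IH].
  by rewrite /ternary_series /series/= big_geq// expr0 invr1 subrr mulr0.
rewrite /ternary_series seriesSr.
have : (b n)%:R / 3 ^+ n.+1 <= (3 ^+ n.+1)^-1 :> R.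
  by rewrite ler_piMl// ?invr_ge0 ?exprn_ge0//; case: (b n).
move: IH; rewrite -/(ternary_series b n).
have -> : (3 ^+ n)^-1 = 3 * (3 ^+ n.+1)^-1 :> R.
  by rewrite exprS invfM mulrA divff// mul1r.
by set w := (3 ^+ n.+1)^-1; lra.
Qed.

Lemma cvg_ternary_code b : ternary_series b @ \oo --> ternary_code b.
Proof.
apply: nondecreasing_is_cvgn; first exact: nondecreasing_ternary_series.
by exists 2^-1 => _ [n _ <-]; exact: ternary_series_le.
Qed.

Lemma ternary_code_ge0 b : 0 <= ternary_code b.
Proof.
apply: limr_ge; first by apply/cvg_ex; eexists; exact: cvg_ternary_code.
by apply: nearW => n; apply: sumr_ge0 => k _; rewrite divr_ge0// exprn_ge0.
Qed.

Lemma ternary_code_le b : ternary_code b <= 2^-1.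
Proof.
apply: limr_le; first by apply/cvg_ex; eexists; exact: cvg_ternary_code.
by apply: nearW => n; exact: ternary_series_le.
Qed.

Lemma ternary_codeS b :
  3 * ternary_code b = (b 0%N)%:R + ternary_code (fun k => b k.+1).
Proof.
have seriesS n :
    3 * ternary_series b n.+1 = (b 0%N)%:R + ternary_series (fun k => b k.+1) n.
  rewrite /ternary_series /series/= big_nat_recl// mulrDr expr1 mulrCA divff// mulr1.
  rewrite mulr_sumr; congr (_ + _); apply: eq_bigr => k _.
  by rewrite mulrCA; congr (_ * _); rewrite exprS invfM mulrA divff// mul1r.
have cvg_lhs : 3 * ternary_series b n.+1 @[n --> \oo] --> 3 * ternary_code b.
  apply: cvgM; first exact: cvg_cst.
  by rewrite (cvg_shiftS (ternary_series b)); exact: cvg_ternary_code.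
have cvg_rhs : 3 * ternary_series b n.+1 @[n --> \oo] -->
    (b 0%N)%:R + ternary_code (fun k => b k.+1).
  under eq_fun do rewrite seriesS.
  by apply: cvgD; [exact: cvg_cst|exact: cvg_ternary_code].
exact: cvg_unique cvg_lhs cvg_rhs.
Qed.

Definition ternary_shift t : R := 3 * t - (1 <= 3 * t)%R%:R.

Definition ternary_digit n t : bool := 1 <= 3 * iter n ternary_shift t.

Lemma ternary_digit0 b : (1 <= 3 * ternary_code b) = b 0%N.
Proof.
have := ternary_code_ge0 (fun k => b k.+1); have := ternary_code_le (fun k => b k.+1).
rewrite ternary_codeS; case: (b 0%N) => /= tail_le tail_ge0.
  by rewrite lerDl.
by rewrite add0r; apply/negbTE; rewrite -ltNge (le_lt_trans tail_le)// invf_lt1// ltr1n.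
Qed.

Lemma ternary_digitK b n : ternary_digit n (ternary_code b) = b n.
Proof.
rewrite /ternary_digit.
suff -> : iter n ternary_shift (ternary_code b) = ternary_code (fun k => b (n + k)%N).
  by rewrite ternary_digit0 addn0.
elim: n => [//|n IH]; rewrite iterS IH /ternary_shift ternary_digit0.
rewrite ternary_codeS addn0 addrAC subrr add0r; congr ternary_code.
by apply/funext => k; rewrite addSnnS.
Qed.

Lemma measurable_ternary_shift : measurable_fun [set: R] ternary_shift.
Proof.
have m3 : measurable_fun [set: R] (fun t : R => 3 * t).
  exact: measurable_funM.
apply: measurable_funB => //.
rewrite (_ : (fun t => _) = (fun b : bool => b%:R : R) \o (fun t : R => 1 <= 3 * t))//.
apply: measurableT_comp => //.
by apply: measurable_fun_ler.
Qed.

Lemma measurable_ternary_digit n : measurable_fun [set: R] (ternary_digit n).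
Proof.
apply: measurable_fun_ler => //; apply: measurable_funM => //.
elim: n => [|n IH]; first exact: measurable_id.
by apply: measurableT_comp IH; exact: measurable_ternary_shift.
Qed.

Lemma measurable_ternary_code d (T : measurableType d) (f : T -> nat -> bool) :
  (forall n, measurable_fun [set: T] (fun x => f x n)) ->
  measurable_fun [set: T] (fun x => ternary_code (f x)).
Proof.
move=> mf; apply: (@measurable_fun_cvg _ _ _ _ (fun n x => ternary_series (f x) n)).
  move=> n; apply: measurable_sum => k; apply: measurable_funM => //.
  exact: (@measurableT_comp _ _ _ _ _ _ (fun b : bool => b%:R : R) _ (f ^~ k)).
by move=> x _; exact: cvg_ternary_code.
Qed.

End ternary_code.

Section sequence_space.
Context {R : realType}.

Lemma measurable_coord (i : nat) : measurable_fun [set: RN R] (fun x : RN R => x i : R).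
Proof.
move=> _ B mB; rewrite setTI; apply: sub_sigma_algebra.
exists i.+1, (fun j => if j == i then B else setT); split.
  by move=> j; case: ifP.
apply/seteqP; split=> x /= h; last by have := h i (leqnn _); rewrite eqxx.
by move=> j _; case: ifPn => // /eqP ->.
Qed.

Lemma measurable_fun_RN d (T : measurableType d) (f : T -> RN R) :
  (forall i, measurable_fun [set: T] (fun x => f x i : R)) ->
  measurable_fun [set: T] f.
Proof.
move=> mf; apply: (@measurability _ _ T (RN R) setT f (@cylinders R)) => //.
move=> _ [_ [m [C [mC ->]]] <-]; rewrite setTI.
rewrite (_ : _ @^-1` _ =
  \bigcap_(i in [set i | (i < m)%N]) ((fun x => f x i : R) @^-1` (C i)))//.
apply: bigcap_measurableType => i _.
by rewrite -[X in measurable X]setTI; exact: mf.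
Qed.

Definition RN_bits (x : RN R) (n : nat) : bool :=
  if unpickle n is Some iq then ratr (iq : nat * rat).2 < (x : nat -> R) iq.1 else false.

(* Ternary rather than binary digits make the coding of bit sequences injective. *)
Definition RN_code (x : RN R) : R := ternary_code (RN_bits x).

Definition rat_below (i n : nat) (t : R) : \bar R :=
  if unpickle n is Some q then
    if ternary_digit (pickle (i, q : rat)) t then (ratr q)%:E else -oo%E
  else -oo%E.

Definition RN_decode (t : R) : RN R := fun i => fine (esups (fun n => rat_below i n t) 0).

Lemma measurable_RN_code : measurable_fun setT RN_code.
Proof.
apply: measurable_ternary_code => n; rewrite /RN_bits.
case: unpickle => [[i q]|//]; apply: measurable_fun_ltr => //.
exact: measurable_coord.
Qed.

Lemma measurable_RN_decode : measurable_fun setT RN_decode.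
Proof.
apply: measurable_fun_RN => i; apply: measurableT_comp => //.
apply: measurable_fun_esups => n; rewrite /rat_below.
case: unpickle => [q|//]; apply: measurable_fun_ifT => //.
exact: measurable_ternary_digit.
Qed.

Lemma rat_below_code (x : RN R) i n : rat_below i n (RN_code x) =
  if unpickle n is Some q then
    if ratr q < (x : nat -> R) i then (ratr q)%:E else -oo%E
  else -oo%E.
Proof.
by rewrite /rat_below; case: unpickle => // q; rewrite ternary_digitK /RN_bits pickleK.
Qed.

Lemma RN_codeK : cancel RN_code RN_decode.
Proof.
move=> x; apply/funext => i; rewrite /RN_decode.
rewrite (_ : esups _ _ = ((x : nat -> R) i)%:E)//.
apply/eqP; rewrite eq_le; apply/andP; split.
  apply: ge_ereal_sup => _ [n _ <-]; rewrite rat_below_code.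
  case: unpickle => [q|]; last exact: leNye.
  by case: ifPn => [/ltW|_]; [rewrite lee_fin|exact: leNye].
apply/lee_subgt0Pr => e e0.
have /rat_in_itvoo[q] : (x : nat -> R) i - e < (x : nat -> R) i.
  by rewrite ltrBlDr ltrDl.
rewrite in_itv/= => /andP[xq qx].
apply: (@le_trans _ _ (ratr q)%:E); first by rewrite -EFinB lee_fin ltW.
by apply: ereal_sup_ubound; exists (pickle q) => //; rewrite rat_below_code pickleK qx.
Qed.

HB.instance Definition _ := isMeasurableFun.Build _ _ _ _ RN_code measurable_RN_code.
HB.instance Definition _ := isMeasurableFun.Build _ _ _ _ RN_decode measurable_RN_decode.

Lemma RN_embedding : borel_embedding (RN R) R.
Proof. exact: BorelEmbedding RN_codeK. Qed.

End sequence_space.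

Section measure_codes.
Context d (T : measurableType d) (R : realType).
Local Open Scope ereal_scope.

Definition cdf_code (P : probability T R) (X : {RV P >-> R}) : R :=
  @RN_embedding R (fun n => if unpickle n is Some q then fine (cdf X (ratr q)) else 0%R).

Lemma cdf_code_inj (P1 P2 : probability T R) (X1 : {RV P1 >-> R}) (X2 : {RV P2 >-> R}) :
  cdf_code X1 = cdf_code X2 ->
  forall A, measurable A -> distribution P1 X1 A = distribution P2 X2 A.
Proof.
move=> /(can_inj (embedK (@RN_embedding R))) eq_cdf; apply: eq_distribution_cdf_rat => q.
have := congr1 (fun x : nat -> R => x (pickle q)) eq_cdf; rewrite pickleK.
by move=> eq_fine; rewrite -[LHS]fineK ?eq_fine ?fineK ?fin_num_measure.
Qed.

Variables (m : {measure set T -> \bar R}) (iota : borel_embedding T R).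

Definition set_code (E : set T) : R :=
  if pselect (measurable E) is left mE
  then cdf_code (embed iota : {RV cond_prob m mE >-> R}) else 0%R.

(* Equal codes would make the conditional probabilities on [A] and on [B] agree,
   although the latter vanishes on [A]. *)
Lemma set_code_neq (A B : set T) : finite_positive m A -> finite_positive m B ->
  m (A `&` B) = 0 -> set_code A <> set_code B.
Proof.
move=> [mA A_gt0 A_lty] [mB B_gt0 B_lty] AB0; rewrite /set_code.
case: pselect => // {}mA; case: pselect => // {}mB /cdf_code_inj.
move=> /(_ _ (measurable_funPTI (retract iota) mA)); rewrite /distribution /pushforward.
rewrite (_ : embed iota @^-1` _ = A); last by apply/seteqP; split=> x /=; rewrite embedK.
rewrite [RHS](cond_prob_eq0 mB B_gt0 B_lty AB0) => condA0.
have := cond_probE mA A_gt0 A_lty A; rewrite condA0 mul0e setIid => A0.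
by rewrite -A0 ltxx in A_gt0.
Qed.

End measure_codes.

Section real_almost_partition.
Context d (T : measurableType d) (R : realType).
Variables (m : {measure set T -> \bar R}) (iota : borel_embedding T R).

Lemma ex_real_almost_partition (J : choiceType) (K : J -> set T) : CH R ->
  (forall j, finite_positive m (K j)) -> almost_disjoint m K ->
  ~ countable [set: J] -> exists F : R -> set T, almost_partition m setT F.
Proof.
move=> ch posK disjK uncJ; have [EE partEE] := ex_almost_partition m.
have uncEE := almost_partition_uncountable partEE posK disjK uncJ.
have set_code_inj : {in EE &, injective (set_code m iota)}.
  move=> A B; rewrite !inE => EEA EEB; apply: contraPP => AB; apply: set_code_neq.
  - exact: partition_positive partEE _ EEA.
  - exact: partition_positive partEE _ EEB.
  - exact: partition_disjoint partEE _ _ EEA EEB AB.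
have codeEE := inj_card_eq set_code_inj.
have EE_R : (EE #= [set: R])%card.
  apply: card_eq_trans (card_esym codeEE) _.
  by have [|//] := ch (set_code m iota @` EE); rewrite (eq_countable codeEE).
have /card_set_bijP[e bij_e] := card_esym EE_R.
by exists e; exact: almost_partition_bij bij_e partEE.
Qed.

End real_almost_partition.

(** * L^p spaces over a charted partition *)

Section glue.
Context d (T : measurableType d) (R : realType).

Lemma ex_measurable_glue (D : nat -> set T) (f_ : nat -> T -> R) :
  (forall k, measurable (D k)) -> trivIset setT D ->
  (forall k, measurable_fun setT (f_ k)) ->
  exists f : T -> R, [/\ measurable_fun setT f, forall k x, D k x -> f x = f_ k x &
    forall x, ~ (\bigcup_k D k) x -> f x = 0].
Proof.
move=> mD tD mf_.
pose f x :=
  if pselect (exists k, D k x) is left ex_k then f_ (projT1 (cid ex_k)) x else 0.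
have fE k x : D k x -> f x = f_ k x.
  move=> Dkx; rewrite /f; case: pselect => [ex_k|]; last by case; exists k.
  by case: cid => l /= Dlx; congr (f_ _ x); apply: tD => //; exists x.
have f0 x : ~ (\bigcup_k D k) x -> f x = 0.
  by rewrite /f; case: pselect => // -[k Dkx] []; exists k.
exists f; split => //; have mU : measurable (\bigcup_k D k) by exact: bigcupT_measurable.
rewrite -(setUv (\bigcup_k D k)); apply/measurable_funU => //; first exact: measurableC.
split.
  apply/measurable_fun_bigcup => // k.
  apply: (eq_measurable_fun (f_ k)); last exact: measurable_funTS.
  by move=> x; rewrite inE => /fE ->.
apply: (eq_measurable_fun (cst (0 : R))); last exact: measurable_cst.
by move=> x; rewrite inE => /f0 ->.
Qed.

Variable m : {measure set T -> \bar R}.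

Lemma ex_glue_almost_disjoint (I : eqType) (F : I -> set T) (e : nat -> I)
    (g : I -> T -> R) :
  (forall i, measurable (F i)) -> almost_disjoint m F ->
  (forall i, measurable_fun setT (g i)) ->
  (forall i, ~ range e i -> g i = cst 0) ->
  exists f : T -> R, [/\ measurable_fun setT f,
    forall x, f x != 0 -> (\bigcup_k F (e k)) x &
    forall i, m.-negligible (F i `\` [set x | f x = g i x])].
Proof.
move=> mF disjF mg g0.
have [|||f [mf fE f0]] := @ex_measurable_glue (seqDU (F \o e)) (g \o e).
- move=> k; apply: measurableD; first exact: mF.
  by apply: bigsetU_measurable => l _; exact: mF.
- exact: trivIset_seqDU.
- by move=> k; exact: mg.
rewrite -seqDU_bigcup_eq in f0; exists f; split=> // [x|i].
  by apply: contraPP => /f0 ->; rewrite eqxx.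
apply: (@negligibleS _ _ _ m (\bigcup_(k in [set k | e k != i]) (F (e k) `&` F i))).
  move=> x [Fix fx_neq].
  have [[k _ Dkx]|notU] := pselect ((\bigcup_k seqDU (F \o e) k) x).
    have ek_neq : e k != i by apply/eqP => eki; apply: fx_neq; rewrite -eki; exact: fE.
    by exists k => //; split => //; case: Dkx.
  rewrite -seqDU_bigcup_eq in notU; have [[k _ eki]|/g0 gi0] := pselect (range e i).
    by case: notU; exists k => //=; rewrite eki.
  by case: fx_neq; rewrite /= f0 ?gi0.
rewrite bigcup_mkcond; apply: negligible_bigcup => k; case: ifPn => [|_].
  by rewrite inE/= => /disjF FF0; apply/negligibleP => //; exact: measurableI.
exact: negligible_set0.
Qed.

End glue.

Section Lp_functions.
Context d (T : measurableType d) (R : realType).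
Local Open Scope ereal_scope.

Definition abs_pow (p : R) (f : T -> R) (x : T) : \bar R := (`|f x| `^ p)%:E.

(* [Lp_on (@mu R)] is convertible to [Lp_mu]. *)
Definition Lp_on (m : set T -> \bar R) (p : R) (f : T -> R) : Prop :=
  measurable_fun setT f /\ \int[m]_x abs_pow p f x < +oo.

Lemma abs_pow_ge0 p f x : 0 <= abs_pow p f x.
Proof. by rewrite lee_fin powR_ge0. Qed.

Lemma measurable_abs_pow p (D : set T) (f : T -> R) :
  measurable_fun D f -> measurable_fun D (abs_pow p f).
Proof.
move=> mf; apply/measurable_EFinP.
apply: (@measurableT_comp _ _ _ _ _ _ (fun x : R => (x `^ p)%R) _ (fun x => `|f x|%R)).
  exact: measurable_powR.
exact: measurableT_comp.
Qed.

Lemma abs_pow_eq0 p f x : (0 < p)%R -> (abs_pow p f x == 0) = (f x == 0%R).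
Proof. by move=> p0; rewrite eqe powR_eq0 normr_eq0 (gt_eqF p0) andbT. Qed.

Variable m : {measure set T -> \bar R}.

Lemma sigma_finite_support (h : T -> \bar R) : measurable_fun setT h ->
  (forall x, 0 <= h x) -> \int[m]_x h x < +oo -> sigma_finite [set x | h x != 0] m.
Proof.
move=> mh h0 inth_lty; exists (fun n => [set x | (n.+1%:R^-1)%:E <= h x]).
  by rewrite -set_gt0E; apply/seteqP; split=> x /=; rewrite lt0e h0 andbT.
move=> n; split.
  by rewrite -[X in measurable X]setTI; exact: emeasurable_fun_c_infty.
have absh x : `|h x| = h x by rewrite gee0_abs.
have : (n.+1%:R^-1)%:E * m [set x | (n.+1%:R^-1)%:E <= h x] <= \int[m]_x h x.
  have := le_integral_abse m measurableT mh (_ : 0 < n.+1%:R^-1)%R; rewrite setTI.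
  under eq_set do rewrite absh; under eq_integral do rewrite absh.
  by apply; rewrite invr_gt0.
rewrite ltey; apply: contraTneq => ->.
by rewrite gt0_muley ?lte_fin ?invr_gt0// -ltNge.
Qed.

End Lp_functions.

Section charted_partition.
Context d (T : measurableType d) (R : realType).
Local Open Scope ereal_scope.
Variables (m : {measure set T -> \bar R}) (J : pointedType) (F : J -> set T).
Hypothesis partF : almost_partition m setT F.
Variable c : forall j, unit_chart m (F j).
Variable p : R.
Hypothesis p_gt0 : (0 < p)%R.

Let posF j : finite_positive m (F j).
Proof. exact: partition_positive partF _ Logic.I. Qed.

Definition mass_root (j : J) : R := (fine (m (F j)) `^ p^-1)%R.

Lemma mass_root_gt0 j : (0 < mass_root j)%R.
Proof. by have [_ F_gt0 F_lty] := posF j; rewrite powR_gt0// fine_gt0// F_gt0. Qed.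

Lemma powR_mass_root j : (mass_root j `^ p)%:E = m (F j).
Proof.
have [_ _ F_lty] := posF j.
rewrite /mass_root -powRrM mulVf ?gt_eqF// powRr1 ?fine_ge0//.
by rewrite fineK// ge0_fin_numE.
Qed.

Definition chart_pull (f : T -> R) (j : J) (u : R) : R :=
  (f (chart (c j) u) * mass_root j)%R.

Lemma measurable_chart_pull f j (D : set (measurableTypeR R)) : measurable_fun setT f ->
  measurable_fun D (chart_pull f j).
Proof.
move=> mf; apply: measurable_funTS; apply: measurable_funM => //.
exact: (measurableT_comp mf).
Qed.

Lemma integral_chart_pull f j : measurable_fun setT f ->
  \int[lebesgue_measure]_(u in `[0%R, 1%R]) abs_pow p (chart_pull f j) u =
  \int[m]_(x in F j) abs_pow p f x.
Proof.
move=> mf; have [_ _ F_lty] := posF j.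
rewrite -(integral_chart (c j) (posF j)); last 2 first.
- exact: measurable_abs_pow.
- by move=> x; exact: abs_pow_ge0.
rewrite -powR_mass_root -ge0_integralZr//; last 3 first.
- by apply: measurable_funTS; apply: (measurableT_comp (measurable_abs_pow p mf)).
- by move=> u _; exact: abs_pow_ge0.
- by rewrite lee_fin powR_ge0.
apply: eq_integral => u _; rewrite /abs_pow /chart_pull normrM powRM// EFinM.
by rewrite (gtr0_norm (mass_root_gt0 j)).
Qed.

Lemma poweR_Lp01_norm (g : R -> R) :
  poweR (Lp01_norm p g) p = \int[lebesgue_measure]_(u in `[0%R, 1%R]) abs_pow p g u.
Proof.
rewrite /Lp01_norm -poweRrM mulVf ?gt_eqF// poweRe1//.
by apply: integral_ge0 => u _; exact: abs_pow_ge0.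
Qed.

Lemma esum_chart_pull (f : T -> R) (S : set T) : measurable_fun setT f ->
  sigma_finite S m -> (forall x, f x != 0%R -> S x) ->
  \esum_(j in setT) poweR (Lp01_norm p (chart_pull f j)) p = \int[m]_x abs_pow p f x.
Proof.
move=> mf sfinS f_supp; rewrite -(esum_integral_partition partF (S := S))//.
- by apply: eq_esum => j _; rewrite poweR_Lp01_norm integral_chart_pull.
- exact: measurable_abs_pow.
- exact: abs_pow_ge0.
- by move=> x; rewrite abs_pow_eq0//; exact: f_supp.
Qed.

Lemma Lp_on_sigma_finite (f : T -> R) :
  Lp_on m p f -> sigma_finite [set x | f x != 0%R] m.
Proof.
move=> [mf f_lty].
have := sigma_finite_support (measurable_abs_pow p mf) (abs_pow_ge0 p f) f_lty.
by under eq_set do rewrite abs_pow_eq0//.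
Qed.

Lemma lp_fam_chart_pull f : Lp_on m p f -> lp_fam p (chart_pull f).
Proof.
move=> Lf; have [mf f_lty] := Lf; split=> [j|].
  split; first exact: measurable_chart_pull.
  rewrite integral_chart_pull//; apply: le_lt_trans f_lty.
  have [mF _ _] := posF j.
  apply: ge0_subset_integral => //; first exact: measurable_abs_pow.
  by move=> x _; exact: abs_pow_ge0.
by rewrite (esum_chart_pull mf (Lp_on_sigma_finite Lf)).
Qed.

Lemma lp_fam_norm_chart_pull f : Lp_on m p f ->
  lp_fam_norm p (chart_pull f) = poweR (\int[m]_x abs_pow p f x) p^-1.
Proof.
move=> Lf; have [mf _] := Lf.
by rewrite /lp_fam_norm (esum_chart_pull mf (Lp_on_sigma_finite Lf)).
Qed.

Lemma chart_pull_ae j (f g : T -> R) : m.-negligible (F j `\` [set x | f x = g x]) ->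
  ae01_eq (chart_pull f j) (chart_pull g j).
Proof.
move=> /(ae_chart (c j) (posF j))/ae_uniform01_lebesgue.
by apply: filterS => u fgu /fgu; rewrite /chart_pull => ->.
Qed.

Definition chart_push (g : R -> R) (j : J) (x : T) : R :=
  ((g \_ `[0%R, 1%R]) (cochart (c j) x) / mass_root j)%R.

Lemma measurable_chart_push (g : R -> R) j :
  measurable_fun (`[0%R, 1%R] : set R) g -> measurable_fun setT (chart_push g j).
Proof.
move=> mg; apply: measurable_funM => //.
apply: (measurableT_comp (f := g \_ `[0%R, 1%R])) => //.
by apply/(measurable_restrictT _ _).1.
Qed.

Lemma chart_pushK (g : R -> R) j : ae01_eq (chart_pull (chart_push g j) j) g.
Proof.
have := ae_uniform01_lebesgue (chartK (c j)); apply: filterS => u cK u01.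
rewrite /chart_pull /chart_push cK// patchE mem_set//.
by rewrite divfK// gt_eqF// mass_root_gt0.
Qed.

Lemma ae01_eq0 (g : R -> R) : Lp01 p g -> poweR (Lp01_norm p g) p = 0 ->
  ae01_eq g (cst 0%R).
Proof.
move=> [mg _]; rewrite poweR_Lp01_norm => intg0.
have mabs : measurable_fun (`[0%R, 1%R] : set (measurableTypeR R)) (abs_pow p g).
  exact: measurable_abs_pow.
have : \int[lebesgue_measure]_(u in `[0%R, 1%R]) `|abs_pow p g u| = 0.
  by rewrite -intg0; apply: eq_integral => u _; rewrite gee0_abs// abs_pow_ge0.
move=> /(ae_eq_integral_abs _ _ mabs).1[//|N [mN N0 ae_g]].
exists N; split=> // u nQ; apply: ae_g => gu0; apply: nQ => /gu0/eqP.
by rewrite abs_pow_eq0// => /eqP.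
Qed.

Lemma Lp_on_chart_pull (f : T -> R) (G : J -> R -> R) (S : set T) : lp_fam p G ->
  measurable_fun setT f -> sigma_finite S m -> (forall x, f x != 0%R -> S x) ->
  (forall j, ae01_eq (chart_pull f j) (G j)) -> Lp_on m p f.
Proof.
move=> [LG G_lty] mf sfinS f_supp fG; split => //.
rewrite -(esum_chart_pull mf sfinS f_supp).
suff -> : \esum_(j in setT) poweR (Lp01_norm p (chart_pull f j)) p =
  \esum_(j in setT) poweR (Lp01_norm p (G j)) p by [].
apply: eq_esum => j _; have [mG _] := LG j.
rewrite [LHS]poweR_Lp01_norm [RHS]poweR_Lp01_norm.
apply: ge0_ae_eq_integral.
- exact: measurable_itv.
- by apply: measurable_abs_pow; exact: measurable_chart_pull.
- exact: measurable_abs_pow.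
- by move=> u _; exact: abs_pow_ge0.
- by move=> u _; exact: abs_pow_ge0.
have := fG j; apply: filterS => u fGu u01.
by rewrite /abs_pow fGu.
Qed.

Lemma chart_pull_surj (G : J -> R -> R) : lp_fam p G ->
  exists2 f, Lp_on m p f & forall j, ae01_eq (chart_pull f j) (G j).
Proof.
move=> LG; have [LG01 G_lty] := LG.
have [e Ge] := countable_enum (esum_countable (fun j => poweR_ge0 _ _) G_lty).
pose g j := if pselect (range e j) is left _ then chart_push (G j) j else cst 0%R.
have mg j : measurable_fun setT (g j).
  rewrite /g; case: pselect => _; last exact: measurable_cst.
  by apply: measurable_chart_push; case: (LG01 j).
have g0 j : ~ range e j -> g j = cst 0%R by rewrite /g; case: pselect.
have [f [mf f_supp f_g]] := ex_glue_almost_disjoint (measurable_partition partF)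
  (almost_disjoint_partition partF) mg g0.
have fG j : ae01_eq (chart_pull f j) (G j).
  apply: ae_eq_trans (chart_pull_ae (f_g j)) _; rewrite /g; case: pselect => [_|nj].
    exact: chart_pushK.
  have G0 : poweR (Lp01_norm p (G j)) p = 0.
    apply/eqP; apply: contra_notT nj => G_neq0; apply: Ge.
    by rewrite /= lt0e G_neq0 poweR_ge0.
  have := ae01_eq0 (LG01 j) G0; apply: filterS => u Gu0 /Gu0 ->.
  by rewrite /chart_pull mul0r.
exists f => //; apply: Lp_on_chart_pull LG mf _ f_supp fG.
by exists (fun k => F (e k)) => // k; have [] := posF (e k).
Qed.

End charted_partition.

(** * The measure mu *)

Section rectangles.
Context {R : realType}.
Local Open Scope ereal_scope.
Implicit Types (C : nat -> set R) (B : set R).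
Local Notation lam := (@lebesgue_measure R).

Lemma partial_vol_ge0 C n : 0 <= partial_vol C n.
Proof. exact: prode_ge0. Qed.

Lemma cvg_finite_rect C (r : R) : (forall i, measurable (C i)) ->
  partial_vol C @ \oo --> r%:E -> finite_rect C.
Proof.
move=> mC Cr; split=> //; exists r; split=> //; rewrite -lee_fin -(cvg_lim _ Cr)//.
apply: lime_ge; first by apply/cvg_ex; eexists; exact: Cr.
by apply: nearW => n; exact: partial_vol_ge0.
Qed.

Lemma finite_rect_cvg C : finite_rect C -> partial_vol C @ \oo --> vol C.
Proof. by move=> [_ [r [_ /[dup] Cr /cvg_lim rE]]]; rewrite /vol rE. Qed.

Lemma vol_ge0 C : finite_rect C -> 0 <= vol C.
Proof. by move=> [_ [r [r0 Cr]]]; rewrite /vol (cvg_lim _ Cr)// lee_fin. Qed.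

Lemma vol_fin_num C : finite_rect C -> vol C \is a fin_num.
Proof. by move=> [_ [r [_ Cr]]]; rewrite /vol (cvg_lim _ Cr). Qed.

Lemma null_rect C j : (forall i, measurable (C i)) -> lam (C j) = 0 ->
  partial_vol C @ \oo --> 0.
Proof.
move=> mC Cj0; apply: cvg_near_cst; exists j.+1 => // n /= jn.
by rewrite /partial_vol (bigD1 (Ordinal jn))//= Cj0 mul0e.
Qed.

Definition restrict_side C i B : nat -> set R := [eta C with i |-> C i `&` B].

Lemma measurable_restrict_side C i B : measurable B ->
  (forall j, measurable (C j)) -> forall j, measurable (restrict_side C i B j).
Proof.
by move=> mB mC j; rewrite /restrict_side/=; case: eqP => // _; exact: measurableI.
Qed.

Lemma rect_restrict_side C i B :
  rect (restrict_side C i B) = rect C `&` [set x : RN R | B (x i)].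
Proof.
apply/seteqP; split=> x; last first.
  by move=> [Cx Bx] j; rewrite /restrict_side/=; case: eqP => // ->.
move=> CBx; split=> [j|]; last by have := CBx i; rewrite /restrict_side/= eqxx => -[].
by have := CBx j; rewrite /restrict_side/=; case: eqP => // -> [].
Qed.

Definition cross_vol C i n : \bar R := \prod_(j < n | j != i :> nat) lam (C j).

Lemma partial_vol_restrict_side C i B n : (i < n)%N ->
  partial_vol (restrict_side C i B) n = lam (C i `&` B) * cross_vol C i n.
Proof.
move=> ltin; rewrite /partial_vol /restrict_side (bigD1 (Ordinal ltin))//= eqxx.
by congr (_ * _); apply: eq_big => // j; rewrite -val_eqE/= => /negbTE ->.
Qed.

Lemma partial_vol_side C i n : (i < n)%N -> partial_vol C n = lam (C i) * cross_vol C i n.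
Proof. by move=> ltin; rewrite /partial_vol (bigD1 (Ordinal ltin)). Qed.

Lemma finite_rect_infinite_side C i : finite_rect C -> lam (C i) = +oo ->
  exists2 j, j != i & lam (C j) = 0.
Proof.
move=> [mC [r [_ /fine_cvgP[[N _ fin_vol] _]]]] Cioo; apply: contrapT => no_null.
have ltin : (i < maxn N i.+1)%N by rewrite leq_maxr.
have := fin_vol (maxn N i.+1) (leq_maxl _ _).
rewrite (partial_vol_side _ ltin) Cioo gt0_mulye// lt0e prode_ge0// andbT.
apply: (big_ind (fun x => x != 0)) => [|x y x0 y0|j ji].
- by rewrite onee_neq0.
- by rewrite mule_eq0 negb_or x0.
- by apply: contra_notN no_null => /eqP Cj0; exists (val j).
Qed.

Lemma finite_rect_restrict_side C i B :
  measurable B -> finite_rect C -> finite_rect (restrict_side C i B).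
Proof.
move=> mB finC; have [mC [r [_ Cr]]] := finC.
have mCB := measurable_restrict_side i mB mC.
have mI : measurable (C i `&` B) by exact: measurableI.
have CB_le : lam (C i `&` B) <= lam (C i) by exact: (measureIl lam (mC i) mB).
have [Ci0|Ci_neq0] := eqVneq (lam (C i)) 0.
  apply: (cvg_finite_rect mCB (r := 0%R)); apply: (null_rect (j := i)) => //.
  by apply/eqP; rewrite /restrict_side/= eqxx eq_le measure_ge0 andbT -Ci0.
have [Cioo|Ci_neqoo] := eqVneq (lam (C i)) +oo.
  have [j /negbTE ji Cj0] := finite_rect_infinite_side finC Cioo.
  apply: (cvg_finite_rect mCB (r := 0%R)); apply: (null_rect (j := j)) => //.
  by rewrite /restrict_side/= ji.
have Ci_fin : lam (C i) \is a fin_num by rewrite ge0_fin_numE ?measure_ge0// ltey.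
have CB_fin : lam (C i `&` B) \is a fin_num.
  by rewrite ge0_fin_numE ?measure_ge0// (le_lt_trans CB_le)// ltey.
pose q := (fine (lam (C i `&` B)) / fine (lam (C i)))%R.
apply: (cvg_finite_rect mCB (r := (q * r)%R)); rewrite EFinM.
apply: cvg_trans (cvgeZl _ Cr) => //; apply: near_eq_cvg.
exists i.+1 => // n /= ltin.
rewrite partial_vol_restrict_side// (partial_vol_side _ ltin) muleA; congr (_ * _).
by rewrite -[lam (C i)]fineK// -EFinM divfK ?fineK// fine_eq0.
Qed.

Lemma vol_restrict_sideC C i B : measurable B -> finite_rect C ->
  vol (restrict_side C i B) + vol (restrict_side C i (~` B)) = vol C.
Proof.
move=> mB finC; have [mC _] := finC; have mBC : measurable (~` B) by exact: measurableC.
have cvgB := finite_rect_cvg (finite_rect_restrict_side i mB finC).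
have cvgBC := finite_rect_cvg (finite_rect_restrict_side i mBC finC).
have fin_volB : vol (restrict_side C i B) \is a fin_num.
  by apply: vol_fin_num; exact: finite_rect_restrict_side.
apply/esym/cvg_lim => //.
apply: cvg_trans (cvgeD (fin_num_adde_defr _ fin_volB) cvgB cvgBC).
apply: near_eq_cvg; exists i.+1 => // n /= ltin.
rewrite !partial_vol_restrict_side// (partial_vol_side _ ltin) -ge0_muleDl//.
by rewrite addeC -setDE -(measureDI lam (mC i) mB).
Qed.

End rectangles.

Section outer_measure.
Context {R : realType}.
Local Open Scope ereal_scope.
Implicit Types (C : nat -> set R) (A : set (RN R)).

Lemma mu_star_ge0 A : 0 <= mu_star A.
Proof.
apply: le_ereal_inf_tmp => _ [D [finD _] <-].
by apply: nneseries_ge0 => n _ _; exact: vol_ge0.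
Qed.

Lemma le_mu_star : {homo @mu_star R : A B / A `<=` B >-> A <= B}.
Proof.
move=> A B AB; apply: ereal_inf_le_tmp => _ [D [finD BD] <-].
by exists D => //; split => //; exact: subset_trans BD.
Qed.

Lemma finite_rect_set0 : finite_rect (fun=> set0 : set R).
Proof.
apply: (cvg_finite_rect (r := 0%R)) => //.
by apply: (null_rect (j := 0%N)) => //; rewrite measure0.
Qed.

Lemma vol_set0 : vol (fun=> set0 : set R) = 0.
Proof. by apply/cvg_lim => //; apply: (null_rect (j := 0%N)) => //; rewrite measure0. Qed.

Lemma mu_star_rect_le C : finite_rect C -> mu_star (rect C) <= vol C.
Proof.
move=> finC; apply: ereal_inf_lbound.
exists (fun n => if n is 0%N then C else fun=> set0).
  by split=> [[|n]//|x Cx]; [exact: finite_rect_set0|exists 0%N].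
rewrite nneseries_recl//; last first.
  by case=> [|n] _; apply: vol_ge0 => //; exact: finite_rect_set0.
by rewrite eseries_cond/= eseries0 ?adde0// => -[|n] // _ _; rewrite vol_set0.
Qed.

Lemma mu_star0 : mu_star (set0 : set (RN R)) = 0.
Proof.
apply/eqP; rewrite eq_le mu_star_ge0 andbT -vol_set0.
by apply: le_trans (mu_star_rect_le finite_rect_set0); exact: le_mu_star.
Qed.

Lemma mu_star_le_esum (D : nat * nat -> nat -> set R) A :
  (forall x, finite_rect (D x)) -> A `<=` \bigcup_x rect (D x) ->
  mu_star A <= \esum_(x in setT) vol (D x).
Proof.
move=> finD AD; have /card_esym/ppcard_eqP[f] := card_nat2.
have bij_f : set_bij setT setT f := bij.
rewrite (reindex_esum setT setT f)// -nneseries_esumT; last by move=> n; exact: vol_ge0.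
apply: ereal_inf_lbound; exists (D \o f) => //; split=> [n|x /AD[y _ Dyx]].
  exact: finD.
by have [_ _ /(_ y I)[n _ fn]] := bij_f; exists n => //=; rewrite fn.
Qed.

Lemma ex_mu_star_cover A (e : R) : mu_star A < +oo -> (0 < e)%R ->
  exists D : nat -> nat -> set R, [/\ forall n, finite_rect (D n),
    A `<=` \bigcup_n rect (D n) & \sum_(0 <= n <oo) vol (D n) <= mu_star A + e%:E].
Proof.
move=> A_lty e0; have A_fin : mu_star A \is a fin_num.
  by rewrite ge0_fin_numE ?mu_star_ge0.
have [_ [D [finD AD] <-] /ltW ?] := lb_ereal_inf_adherent e0 A_fin.
by exists D.
Qed.

Lemma mu_star_sigma_subadditive : sigma_subadditive (@mu_star R).
Proof.
move=> A; apply/lee_addgt0Pr => e e0.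
have [[i Aioo]|A_neqoo] := pselect (exists i, mu_star (A i) = +oo).
  rewrite (eseries_pinfty _ _ Aioo) ?leey// => n _.
  by rewrite -ltNye (lt_le_trans _ (mu_star_ge0 _)).
rewrite (le_trans _ (epsilon_trick _ _ (ltW e0)))//; last first.
  by move=> n; exact: mu_star_ge0.
have A_lty n : mu_star (A n) < +oo.
  by rewrite ltey; apply: contra_notN A_neqoo => /eqP ?; exists n.
have eps_gt0 n : (0 < e / (2 ^ n.+1)%:R)%R by rewrite divr_gt0// ltr0n expn_gt0.
have [D coverD] := choice (fun n => ex_mu_star_cover (A_lty n) (eps_gt0 n)).
have finD n k : finite_rect (D n k) by have [] := coverD n.
apply: (@le_trans _ _ (\esum_(x in setT) vol (D x.1 x.2))).
  apply: mu_star_le_esum => [x|x [n _ Anx]]; first exact: finD.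
  have [_ /(_ _ Anx)[k _ Dx] _] := coverD n.
  by exists (n, k).
have -> : \esum_(x in setT) vol (D x.1 x.2) =
    \sum_(0 <= n <oo) \sum_(0 <= k <oo) vol (D n k).
  have D_ge0 n k : 0 <= vol (D n k) by exact: vol_ge0.
  rewrite nneseries_esumT => [|n]; last exact: nneseries_ge0.
  under [RHS]eq_esum do rewrite nneseries_esumT//.
  by rewrite esum_esum//; congr esum; apply/seteqP; split.
apply: lee_nneseries => [n _ _|n _]; last by have [] := coverD n.
by apply: nneseries_ge0 => k _ _; exact: vol_ge0.
Qed.

HB.instance Definition _ := isOuterMeasure.Build R (RN R) (@mu_star R)
  mu_star0 mu_star_ge0 le_mu_star mu_star_sigma_subadditive.

Lemma caratheodory_side i (B : set R) : measurable B ->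
  (@mu_star R).-caratheodory [set x | B (x i)].
Proof.
move=> mB; apply: (@le_caratheodory_measurable R _ (@mu_star R)) => X.
have mBC : measurable (~` B) by exact: measurableC.
apply: le_ereal_inf_tmp => _ [D [finD XD] <-].
have vol_side_ge0 n B' : measurable B' -> 0 <= vol (restrict_side (D n) i B').
  by move=> mB'; apply: vol_ge0; exact: finite_rect_restrict_side.
rewrite (eq_eseriesr (fun n _ => esym (vol_restrict_sideC i mB (finD n)))).
rewrite nneseriesD; [|by move=> n _ _; exact: vol_side_ge0..].
have cover_side B' : measurable B' ->
    mu_star (X `&` [set x | B' (x i)]) <=
    \sum_(0 <= n <oo) vol (restrict_side (D n) i B').
  move=> mB'; apply: ereal_inf_lbound; exists (fun n => restrict_side (D n) i B') => //.
  split=> [n|x [/XD[n _ Dx] B'x]]; first exact: finite_rect_restrict_side.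
  by exists n => //; rewrite rect_restrict_side.
by apply: leeD; exact: cover_side.
Qed.

Lemma measurable_caratheodory A : measurable A -> (@mu_star R).-caratheodory A.
Proof.
apply: smallest_sub.
  exact: (@sigma_algebra_measurable _ (caratheodory_type (@mu_star R))).
move=> _ [m [C [mC ->]]].
rewrite (_ : [set x | _] = \bigcap_(i in [set i | (i < m)%N]) [set x | C i (x i)])//.
have mside i : [set i | (i < m)%N] i ->
    measurable ([set x | C i (x i)] : set (caratheodory_type (@mu_star R))).
  by move=> _; exact: caratheodory_side.
exact: bigcap_measurableType mside.
Qed.

Lemma muE A : measurable A -> mu A = mu_star A.
Proof. by move=> mA; rewrite /mu asboolT. Qed.

Lemma mu0 : mu (set0 : set (RN R)) = 0.
Proof. by rewrite muE// mu_star0. Qed.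

Lemma mu_ge0 A : 0 <= mu A.
Proof. by rewrite /mu; case: ifP => // _; exact: mu_star_ge0. Qed.

Lemma mu_semi_sigma_additive : semi_sigma_additive (@mu R).
Proof.
move=> F mF tF mUF; rewrite muE//.
rewrite (_ : (fun n => _) = (fun n => \sum_(0 <= i < n) mu_star (F i))); last first.
  by apply/funext => n; apply: eq_bigr => i _; rewrite muE.
apply: (@caratheodory_measure_sigma_additive _ _ (@mu_star R)) => //.
- by move=> i; exact: measurable_caratheodory.
- exact: measurable_caratheodory.
Qed.

HB.instance Definition _ := isMeasure.Build _ (RN R) R (@mu R)
  mu0 mu_ge0 mu_semi_sigma_additive.

End outer_measure.

Section cylinder_covers.
Context {R : realType}.
Local Open Scope ereal_scope.
Local Notation lam := (@lebesgue_measure R).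

Lemma ex_sum_indic_lt1 (J : set (measurableTypeR R))
    (B : nat -> set (measurableTypeR R)) (w : nat -> \bar R) :
  measurable J -> lam J = 1 -> (forall n, measurable (B n)) ->
  (forall n, 0 <= w n) -> \sum_(n <oo) lam (J `&` B n) * w n < 1 ->
  exists2 y, J y & \sum_(n <oo) (\1_(B n) y)%:E * w n < 1.
Proof.
move=> mJ J1 mB w0; rewrite ltNge; apply: contraNP => no_y.
have sum_ge1 y : J y -> 1 <= \sum_(n <oo) (\1_(B n) y)%:E * w n.
  by move=> Jy; rewrite leNgt; apply/negP => ?; apply: no_y; exists y.
have indic_w_ge0 n y : 0 <= (\1_(B n) y)%:E * w n by rewrite mule_ge0// lee_fin.
have mindic n : measurable_fun J (fun y => (\1_(B n) y : R)%:E).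
  by apply/measurable_EFinP; exact: measurable_indic.
have mindic_w n : measurable_fun J (fun y => (\1_(B n) y)%:E * w n).
  exact: emeasurable_funM.
have -> : \sum_(n <oo) lam (J `&` B n) * w n =
    \int[lam]_(y in J) \sum_(n <oo) (\1_(B n) y)%:E * w n.
  rewrite integral_nneseries//; apply: eq_eseriesr => n _.
  by rewrite ge0_integralZr// integral_indic// setIC.
rewrite -[leLHS]J1 -[leLHS]mul1e -(integral_cst _ mJ).
by apply: ge0_le_integral => //; exact: ge0_emeasurable_sum.
Qed.

Section cover.
Variables (J : nat -> set R) (E : nat -> nat -> set R) (m : nat -> nat).
Hypotheses (mJ : forall i, measurable (J i)) (J1 : forall i, lam (J i) = 1).
Hypotheses (mE : forall n i, measurable (E n i)).
Hypothesis E_cylinder : forall n i, (m n <= i)%N -> E n i = setT.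

Let slice_vol n k := \prod_(k <= i < m n) lam (J i `&` E n i).

Let slice_vol_ge0 n k : 0 <= slice_vol n k.
Proof. exact: prode_ge0. Qed.

Let slice_volS n k : lam (J k `&` E n k) * slice_vol n k.+1 = slice_vol n k.
Proof.
rewrite /slice_vol; have [kn|nk] := ltnP k (m n); first by rewrite [RHS]big_ltn.
by rewrite !big_geq// ?(leqW nk)// E_cylinder// setIT J1 mul1e.
Qed.

Let residual k (A : set nat) := \sum_(n <oo) (\1_A n : R)%:E * slice_vol n k.

Let residual_step k A : residual k A < 1 ->
  exists2 y, J k y & residual k.+1 (A `&` [set n | E n k y]) < 1.
Proof.
have w_ge0 n : 0 <= (\1_A n : R)%:E * slice_vol n k.+1 by rewrite mule_ge0// lee_fin.
have -> : residual k A =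
    \sum_(n <oo) lam (J k `&` E n k) * ((\1_A n)%:E * slice_vol n k.+1).
  by apply: eq_eseriesr => n _; rewrite muleCA slice_volS.
move=> /(ex_sum_indic_lt1 (mJ k) (J1 k) (fun n => mE n k) w_ge0)[y Jy lt1].
exists y => //; rewrite (_ : residual _ _ = \sum_(n <oo) (\1_(E n k) y)%:E *
  ((\1_A n)%:E * slice_vol n k.+1))//.
apply: eq_eseriesr => n _; rewrite muleA -EFinM mulrC; congr (_%:E * _).
by rewrite indicI.
Qed.

(* Fubini one coordinate at a time: as long as the conditional volumes of the
   cylinders still meeting the prefix [x_0, ..., x_(k-1)] sum to less than 1,
   some [x_k] keeps them so; the limit point then avoids every cylinder. *)
Lemma cylinder_cover_ge1 : rect J `<=` \bigcup_n rect (E n) ->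
  1 <= \sum_(n <oo) \prod_(0 <= i < m n) lam (J i `&` E n i).
Proof.
move=> JE; rewrite leNgt; apply/negP => lt1.
have [next nextP] : {next : nat * set nat -> R & forall kA, residual kA.1 kA.2 < 1 ->
    J kA.1 (next kA) /\ residual kA.1.+1 (kA.2 `&` [set n | E n kA.1 (next kA)]) < 1}.
  apply: (@choice _ _ (fun kA y => residual kA.1 kA.2 < 1 ->
    J kA.1 y /\ residual kA.1.+1 (kA.2 `&` [set n | E n kA.1 y]) < 1)) => -[k A] /=.
  have [/residual_step[y Jy lty]|nlt] := pselect (residual k A < 1); first by exists y.
  by exists point.
pose alive := fix alive k :=
  if k is k'.+1 then alive k' `&` [set n | E n k' (next (k', alive k'))] else setT.
pose x k := next (k, alive k).
have alive_lt1 k : residual k (alive k) < 1.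
  elim: k => [|k IHk]; last by have [] := nextP (k, alive k) IHk.
  by rewrite /residual; under eq_eseriesr do rewrite indicT mul1e.
have Jx : rect J x by move=> k; have [] := nextP (k, alive k) (alive_lt1 k).
have [n _ Enx] := JE _ Jx.
have alive_n k : alive k n by elim: k => //= k IHk; split => //; exact: Enx.
have := alive_lt1 (m n); apply/negP; rewrite -leNgt /residual.
rewrite (@nneseriesD1 _ _ n)//; last first.
  by move=> i _; rewrite mule_ge0// lee_fin.
rewrite indicE mem_set// mul1e /slice_vol big_geq// leeDl//.
by apply: nneseries_ge0 => i _ _; apply: mule_ge0 => //; exact: (slice_vol_ge0 i (m n)).
Qed.

End cover.

Lemma ex_partial_vol_le (C : nat -> set R) (e : R) : finite_rect C -> (0 < e)%R ->
  exists n, partial_vol C n <= vol C + e%:E.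
Proof.
move=> finC e0; have vol_lt : vol C < vol C + e%:E by rewrite lteDl// vol_fin_num.
have [N _ /(_ N (leqnn N))/ltW ?] := finite_rect_cvg finC (open_ereal_lt_ereal vol_lt).
by exists N.
Qed.

Lemma mu_star_rect_ge1 (J : nat -> set R) : (forall i, measurable (J i)) ->
  (forall i, lam (J i) = 1) -> 1 <= mu_star (rect J).
Proof.
move=> mJ J1; apply: le_ereal_inf_tmp => _ [D [finD JD] <-].
apply/lee_addgt0Pr => e e0.
rewrite (le_trans _ (epsilon_trick _ _ (ltW e0)))//; last first.
  by move=> n; exact: vol_ge0.
have eps_gt0 n : (0 < e / (2 ^ n.+1)%:R)%R by rewrite divr_gt0// ltr0n expn_gt0.
have [m partial_volD_le] := choice (fun n => ex_partial_vol_le (finD n) (eps_gt0 n)).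
have mD n i : measurable (D n i) by have [] := finD n.
pose E n i := if (i < m n)%N then D n i else setT.
have mE n i : measurable (E n i) by rewrite /E; case: ifP.
have JE : rect J `<=` \bigcup_n rect (E n).
  by move=> x /JD[n _ Dx]; exists n => // i; rewrite /E; case: ifP.
have E_cylinder n i : (m n <= i)%N -> E n i = setT by rewrite /E ltnNge => ->.
apply: le_trans (cylinder_cover_ge1 mJ J1 mE E_cylinder JE) _.
apply: lee_nneseries => [n _ _|n _]; first exact: prode_ge0.
apply: le_trans (partial_volD_le n); rewrite big_mkord.
suff /andP[] : 0 <= \prod_(i < m n) lam (J i `&` E n i) <= partial_vol (D n) (m n) by [].
apply: (big_ind2 (fun x y => 0 <= x <= y)) => [|x y x' y' /andP[? ?] /andP[? ?]|i _].
- by rewrite lexx andbT.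
- by rewrite mule_ge0//= lee_pmul.
by rewrite measure_ge0/= /E ltn_ord setIC; exact: (measureIl lam (mD n i) (mJ i)).
Qed.

End cylinder_covers.

Section baker_measure.
Context {R : realType}.
Local Open Scope ereal_scope.
Local Notation lam := (@lebesgue_measure R).

Lemma measurable_rect (C : nat -> set R) : (forall i, measurable (C i)) ->
  measurable (rect C : set (RN R)).
Proof.
move=> mC.
rewrite (_ : rect C = \bigcap_i ((fun x : RN R => (x : nat -> R) i) @^-1` (C i))).
  apply: bigcapT_measurable => i.
  by rewrite -[X in measurable X]setTI; exact: measurable_coord.
by apply/seteqP; split=> [x Cx i _|x Cx i]; [exact: Cx|exact: (Cx i I)].
Qed.

Lemma mu_rect_le (C : nat -> set R) (r : R) : (forall i, measurable (C i)) ->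
  partial_vol C @ \oo --> r%:E -> mu (rect C) <= r%:E.
Proof.
move=> mC Cr; rewrite muE; last exact: measurable_rect.
by rewrite -(cvg_lim _ Cr)//; exact: mu_star_rect_le (cvg_finite_rect mC Cr).
Qed.

Lemma mu_set1 (x : RN R) : mu [set x] = 0.
Proof.
pose point_side i := [set (x : nat -> R) i].
have -> : [set x] = rect point_side.
  by apply/seteqP; split=> [y -> i//|y yx]; apply/funext => i; exact: (yx i).
have mside i : measurable (point_side i) by exact: measurable_set1.
have vol0 : partial_vol point_side @ \oo --> 0.
  by apply: (null_rect (j := 0%N)) => //; exact: lebesgue_measure_set1.
by apply/eqP; rewrite eq_le mu_ge0 andbT; exact: mu_rect_le vol0.
Qed.

Definition unit_cube (b : nat -> bool) : set (RN R) :=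
  rect (fun i => `[((b i)%:R : R), ((b i)%:R + 1)%R[%classic).

Lemma finite_positive_unit_cube b : finite_positive (@mu R) (unit_cube b).
Proof.
pose side i := `[((b i)%:R : R), ((b i)%:R + 1)%R[%classic.
have mside i : measurable (side i) by exact: measurable_itv.
have side1 i : lam (side i) = 1.
  by rewrite lebesgue_measure_itv/= lte_fin ltrDl ltr01 -EFinB addrAC subrr add0r.
have mcube : measurable (unit_cube b) by exact: measurable_rect.
split => //; first by rewrite muE// (lt_le_trans _ (mu_star_rect_ge1 mside side1)).
apply: le_lt_trans (ltry 1%R); apply: mu_rect_le => //.
apply: cvg_near_cst; apply: nearW => n.
by rewrite /partial_vol big1// => i _; exact: side1.
Qed.

Lemma unit_cube_disjoint b b' : b <> b' -> unit_cube b `&` unit_cube b' = set0.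
Proof.
move=> bb'; rewrite -subset0 => x [xb xb']; apply: bb'; apply/funext => i.
move: (xb i) (xb' i); rewrite /= !in_itv/=.
by case: (b i); case: (b' i) => //= /andP[? ?] /andP[? ?]; lra.
Qed.

Lemma almost_disjoint_unit_cube : almost_disjoint (@mu R) unit_cube.
Proof. by move=> b b' /eqP bb'; rewrite unit_cube_disjoint ?measure0. Qed.

End baker_measure.

Theorem theorem1p1 (R : realType) (p : R) :
  CH R -> 1 <= p -> isometric_iso_Lp_mu_lp R p.
Proof.
move=> ch p_ge1; have p_gt0 : 0 < p by exact: lt_le_trans p_ge1.
have [F partF] := ex_real_almost_partition (@RN_embedding R) ch
  (@finite_positive_unit_cube R) (@almost_disjoint_unit_cube R) uncountable_bool_seq.
have posF j : finite_positive (@mu R) (F j) by exact: partition_positive partF _ I.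
pose c j : unit_chart (@mu R) (F j) :=
  nonatomic_unit_chart (@RN_embedding R) (@mu_set1 R) (posF j).
exists (chart_pull c p); split; first exact: lp_fam_chart_pull.
split.
  move=> f g _ _ [N [mN [N0 fgN]]] j; apply: (chart_pull_ae partF).
  by exists N; split=> // x [_]; exact: fgN.
split.
  by move=> a b f g _ _ j; apply: aeW => u _; rewrite /chart_pull mulrDl !mulrA.
split; first exact: lp_fam_norm_chart_pull.
by move=> G /(chart_pull_surj partF c p_gt0)[f Lf fG]; exists f.
Qed.
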